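(* Let $k$ be an odd integer and let $G$ be a $k$-edge-connected $k$-regular graph. Then $\mathrm{srd}(G)=k$ if and only if $\mathrm{rd}(G)=k$.
   Context: An edge-coloring of $G$ is any map $c:E(G)\to[m]$ (adjacent edges may receive the same color). For distinct vertices $u,v$ of a connected graph $G$, a $u$-$v$-edge-cut is a set $F$ of edges such that $u$ and $v$ lie in different components of $G-F$; a minimum $u$-$v$-edge-cut is one of minimum size among these. A set of edges is rainbow if no two of its edges have the same color. An edge-colored connected graph is rainbow disconnected if for every two distinct vertices $u,v$ there is a rainbow $u$-$v$-edge-cut; $\mathrm{rd}(G)$ is the smallest number of colors of an edge-coloring making $G$ rainbow disconnected. An edge-colored connected graph is strong rainbow disconnected if for every two distinct vertices $u,v$ there is a $u$-$v$-edge-cut that is both rainbow and minimum; $\mathrm{srd}(G)$ is the smallest number of colors of an edge-coloring making $G$ strong rainbow disconnected. *)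

(* Defs.v *)
From mathcomp Require Import all_boot.

Set Implicit Arguments.
Unset Strict Implicit.
Unset Printing Implicit Defensive.

Record sgraph := SGraph {
  vertex :> finType;
  adj : rel vertex;
  adj_sym : symmetric adj;
  adj_irr : irreflexive adj
}.

Definition edge_set (G : sgraph) : {set {set G}} :=
  [set [set p.1; p.2] | p in [pred p : G * G | adj p.1 p.2]].

Notation edge G := {f : {set G} | f \in edge_set G}.

Section Graph.
Variable G : sgraph.

Definition degree (v : G) : nat := #|[set w | adj v w]|.

Definition regular (k : nat) : Prop := forall v : G, degree v = k.

(* Adjacency in G - F. *)
Definition del_adj (F : {set edge G}) : rel G :=
  fun x y => [exists f : edge G, (val f == [set x; y]) && (f \notin F)].

(* The empty and the one-vertex graph have edge-connectivity 0 by convention,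
   hence the cardinality condition. *)
Definition edge_connected (k : nat) : Prop :=
  [/\ 0 < k -> 1 < #|G| &
      forall F : {set edge G}, #|F| < k ->
        forall x y : G, connect (del_adj F) x y].

Definition edge_cut (u v : G) (F : {set edge G}) : bool :=
  ~~ connect (del_adj F) u v.

Definition min_edge_cut (u v : G) (F : {set edge G}) : bool :=
  edge_cut u v F && [forall F' : {set edge G}, edge_cut u v F' ==> (#|F| <= #|F'|)].

Section Coloring.
Variables (m : nat) (c : {ffun edge G -> 'I_m}).

Definition rainbow (F : {set edge G}) : bool :=
  [forall f in F, forall g in F, (f != g) ==> (c f != c g)].

Definition rainbow_disconnected : bool :=
  [forall u : G, forall v : G, (u != v) ==>
    [exists F : {set edge G}, edge_cut u v F && rainbow F]].

Definition strong_rainbow_disconnected : bool :=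
  [forall u : G, forall v : G, (u != v) ==>
    [exists F : {set edge G}, min_edge_cut u v F && rainbow F]].

End Coloring.

Definition rd_colorable (m : nat) : bool :=
  [exists c : {ffun edge G -> 'I_m}, rainbow_disconnected c].

Definition srd_colorable (m : nat) : bool :=
  [exists c : {ffun edge G -> 'I_m}, strong_rainbow_disconnected c].

Lemma edge_cut_setT (u v : G) : u != v -> edge_cut u v setT.
Proof.
move=> uv; apply/negP => /connectP[[|w p]] /=.
  by move=> _ vu; rewrite vu eqxx in uv.
by case/andP=> /existsP[f]; rewrite in_setT andbF.
Qed.

Lemma min_edge_cut_exists (u v : G) :
  u != v -> exists F : {set edge G}, min_edge_cut u v F.
Proof.
move=> /edge_cut_setT uvT.
case: (arg_minnP (fun F : {set edge G} => #|F|) uvT) => F cutF minF.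
exists F; apply/andP; split=> //.
by apply/forallP => F'; apply/implyP; apply: minF.
Qed.

Lemma srd_colorable_exists : exists m, srd_colorable m.
Proof.
exists #|{: edge G}|; apply/existsP; exists [ffun f => enum_rank f].
apply/forallP => u; apply/forallP => v; apply/implyP => uv.
have [F minF] := min_edge_cut_exists uv.
apply/existsP; exists F; rewrite minF /=.
apply/forall_inP => f _; apply/forall_inP => g _; apply/implyP.
by rewrite !ffunE (inj_eq enum_rank_inj).
Qed.

Lemma rd_colorable_exists : exists m, rd_colorable m.
Proof.
have [m /existsP[c /forallP cP]] := srd_colorable_exists.
exists m; apply/existsP; exists c; apply/forallP => u; apply/forallP => v.
apply/implyP => uv; have /existsP[F /andP[/andP[cutF _] rF]] :=
  implyP (forallP (cP u) v) uv.
by apply/existsP; exists F; rewrite cutF rF.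
Qed.

Definition rd : nat := ex_minn rd_colorable_exists.

Definition srd : nat := ex_minn srd_colorable_exists.

End Graph.

(* Main.v *)
(** Edge-connectivity makes every edge-cut have at least [k] edges, while a
    rainbow set of edges has at most as many edges as there are colors. So
    [k <= rd G <= srd G], and with exactly [k] colors a rainbow edge-cut has
    exactly [k] edges and is therefore minimum. *)
Require Import Defs.
From mathcomp Require Import all_boot.

Lemma card_edge_cut {k : nat} {G : sgraph} {u v : G} {F : {set edge G}} :
  edge_connected G k -> edge_cut u v F -> k <= #|F|.
Proof.
move=> [_ conn] cutF; rewrite leqNgt; apply/negP => ltFk.
by rewrite /edge_cut conn in cutF.
Qed.

Lemma card_rainbow {G : sgraph} {m : nat} {c : {ffun edge G -> 'I_m}}
    {F : {set edge G}} :
  rainbow c F -> #|F| <= m.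
Proof.
(* Rainbow amounts to injectivity of [c] on [F], so [F] is as large as its image in ['I_m]. *)
move=> rF; have inj_c : {in F &, injective c}.
  move=> f g fF gF cfg; apply/eqP; apply: contraT => neq_fg.
  have /forall_inP/(_ g gF)/implyP/(_ neq_fg) := forall_inP rF f fF.
  by rewrite cfg eqxx.
by rewrite -(card_in_imset inj_c) -[leqRHS]card_ord max_card.
Qed.

Lemma srd_colorable_rd (G : sgraph) (m : nat) :
  srd_colorable G m -> rd_colorable G m.
Proof.
move=> /existsP[c /forallP cP]; apply/existsP; exists c.
apply/forallP => u; apply/forallP => v; apply/implyP => uv.
have /existsP[F /andP[/andP[cutF _] rF]] := implyP (forallP (cP u) v) uv.
by apply/existsP; exists F; rewrite cutF.
Qed.

(** The coloring itself need not change: each of its rainbow cuts has at most [k] edges, and no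
    edge-cut has fewer. *)
Lemma rd_colorable_srd (k : nat) (G : sgraph) :
  edge_connected G k -> rd_colorable G k -> srd_colorable G k.
Proof.
move=> conn /existsP[c /forallP cP]; apply/existsP; exists c.
apply/forallP => u; apply/forallP => v; apply/implyP => uv.
have /existsP[F /andP[cutF rF]] := implyP (forallP (cP u) v) uv.
apply/existsP; exists F; rewrite /min_edge_cut cutF rF andbT /=.
apply/forallP => F'; apply/implyP => cutF'.
exact: leq_trans (card_rainbow rF) (card_edge_cut conn cutF').
Qed.

Lemma rd_colorable_ge (k m : nat) (G : sgraph) :
  edge_connected G k -> rd_colorable G m -> k <= m.
Proof.
move=> conn /existsP[c /forallP cP]; case: (posnP k) => [-> // | k_gt0].
(* A pair of distinct vertices is needed to get any cut from the coloring; the cardinality clause of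
   [edge_connected] provides one when [k] is positive. *)
have [/(_ k_gt0)/card_gt1P[u [v [_ _ uv]]] _] := conn.
have /existsP[F /andP[cutF rF]] := implyP (forallP (cP u) v) uv.
exact: leq_trans (card_edge_cut conn cutF) (card_rainbow rF).
Qed.

Theorem theorem3p10 (k : nat) (G : sgraph) (hk : odd k)
    (hconn : edge_connected G k) (hreg : regular G k) :
  srd G = k <-> rd G = k.
Proof.
rewrite /srd /rd; case: ex_minnP => s sP s_min; case: ex_minnP => r rP r_min.
have le_rs : r <= s by apply/r_min/srd_colorable_rd.
have le_kr : k <= r by apply: rd_colorable_ge rP.
split=> [sk | rk]; apply/eqP; rewrite eqn_leq.
  by rewrite le_kr -sk le_rs.
rewrite (leq_trans le_kr le_rs) andbT.
(* Minimality of [s] reduces [s <= k] to a strong coloring with [k = r] colors, which the coloring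
   attaining [r] provides. *)
by apply/s_min/rd_colorable_srd; rewrite // -[X in rd_colorable _ X]rk.
Qed.
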